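(* Let $s\in\mathbb{C}$ and, for $k\in L$, let $q_k=\tilde p\big(H(k+\frac H2)+1\big)$. Define $Z_s\in A$ by $$Z_s(a)=\prod_{k\in L}q_k^{-s\left(a(k)+\frac{H'}{2}\right)}\qquad(a\in X).$$ Then for every $b\in X$, writing $w_k=2\pi i\,b(k)+s\log q_k$, $$(FZ_s)(b)=\Big(\prod_{k\in L}q_k\Big)^{-s\frac{H'}{2}}\prod_{k\in L}\varepsilon'\,\frac{\sinh\!\big(w_k\frac{H'}{2}\big)}{\exp\!\big(-\frac{\varepsilon'}{2}w_k\big)\sinh\!\big(\frac{\varepsilon'}{2}w_k\big)}.$$
   Context: Double nonstandard framework: ${}^{*}S=S^{\Lambda_2}/F_2$ for a nonprincipal ultrafilter $F_2$ on an infinite set $\Lambda_2$; for a ${}^*$-internal set $S$, ${}^{\star}S$ is its ${}^*$-ultrapower with respect to ${}^*F_1$, $F_1$ a nonprincipal ultrafilter on an infinite set $\Lambda_1$; ${}^\star x$ is the image of $x$; ''internal'' means internal with a double meaning. Let $H\in{}^{*}\mathbb{Z}$ be a positive even infinite number and $H'\in{}^{\star}({}^{*}\mathbb{Z})$ a positive even number larger than every element of ${}^{*}\mathbb{Z}$; $\varepsilon=1/H$, $\varepsilon'=1/H'$. $L=\{\varepsilon z: z\in{}^*\mathbb{Z},\,-H/2\le\varepsilon z<H/2\}$ and $L'=\{\varepsilon' z': z'\in{}^{\star}({}^{*}\mathbb{Z}),\,-\frac{H'}{2}\le \varepsilon' z'<\frac{H'}{2}\}$. $X$ is the set of internal functions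 ${}^{\star}L\to L'$, $A$ the set of internal functions $X\to{}^{\star}({}^{*}\mathbb{C})$, $\varepsilon_0=H'^{-({}^{\star}H)^2}$, and $(Ff)(b)=\sum_{a\in X}\varepsilon_0\exp\big(-2\pi i\sum_{k\in L}a(k)b(k)\big)f(a)$. Let $p:\mathbb{N}\to\{\text{primes}\}$ be the increasing enumeration $p(1)=2,p(2)=3,\dots$; its extension ${}^*p:{}^*\mathbb{N}\to{}^*\{\text{primes}\}$ is ${}^*p([l_\mu])=[p(l_\mu)]$, and $\tilde p:{}^*\mathbb{N}\to{}^{\star}({}^*\{\text{primes}\})$ is $\tilde p([l_\mu])={}^{\star}[p(l_\mu)]$. For $k\in L$, $H(k+\frac H2)+1\in{}^*\mathbb{N}$ ranges over $1,\dots,H^2$. Complex powers are $q^{z}=\exp(z\log q)$ with the real logarithm. (The paper writes $F(\mathbf{e}^\sharp(Z_s))$, i.e. $Z_s$ regarded as a functional on $X$.)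
   Formalization: Where sinh(ε'w_k/2)=0 (e.g. s=0 and b(k)=0) the quotient in the formula is 0/0 and undefined; there it is read as its limit in w (internal ε–δ), and elsewhere it is the literal quotient. *)

(* Defs.v *)
From HB Require Import structures.
From mathcomp Require Import all_boot all_order all_algebra finmap.
From mathcomp Require Import complex.
From mathcomp Require Import all_classical reals sequences exp trigo.

Set Implicit Arguments.
Unset Strict Implicit.
Unset Printing Implicit Defensive.

Import Order.TTheory GRing.Theory Num.Theory.
Local Open Scope classical_set_scope.
Local Open Scope ring_scope.

Record npultrafilter (I : Type) := NPUltrafilter {
  uf :> set_system I;
  uf_ultra : UltraFilter uf;
  uf_nonprincipal : forall i : I, ~ uf [set i]
}.
#[global] Existing Instance uf_ultra.

Definition ae_class (I : Type) (F : npultrafilter I) (T : Type) (f : I -> T) :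
  set (I -> T) := [set g | uf F [set i | f i = g i]].

Record ultrapower (I : Type) (F : npultrafilter I) (T : Type) := Ultrapower {
  ucarrier : set (I -> T);
  ucarrierP : exists f, ucarrier = ae_class F f
}.

Definition uclass (I : Type) (F : npultrafilter I) (T : Type) (f : I -> T) :
  ultrapower F T := Ultrapower (ex_intro _ f (erefl (ae_class F f))).

Definition urepr (I : Type) (F : npultrafilter I) (T : Type)
  (x : ultrapower F T) : I -> T := projT1 (cid (ucarrierP x)).

Definition ucst (I : Type) (F : npultrafilter I) (T : Type) (x : T) :
  ultrapower F T := uclass F (fun=> x).

Definition ulift1 (I : Type) (F : npultrafilter I) (A B : Type) (f : A -> B)
  (x : ultrapower F A) : ultrapower F B := uclass F (fun i => f (urepr x i)).

Definition ulift2 (I : Type) (F : npultrafilter I) (A B C : Type)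
  (f : A -> B -> C) (x : ultrapower F A) (y : ultrapower F B) :
  ultrapower F C := uclass F (fun i => f (urepr x i) (urepr y i)).

Definition ulift_rel (I : Type) (F : npultrafilter I) (A B : Type)
  (r : A -> B -> Prop) (x : ultrapower F A) (y : ultrapower F B) : Prop :=
  uf F [set i | r (urepr x i) (urepr y i)].

Section UltrapowerTheory.
Context {I : Type} (F : npultrafilter I).

Lemma uclassP (T : Type) (f g : I -> T) :
  uclass F f = uclass F g <-> uf F [set i | f i = g i].
Proof.
split=> [[]fg|fg].
  have : ae_class F g g by apply: filterS filterT => i _.
  by rewrite -fg.
have e : ae_class F f = ae_class F g.
  apply/seteqP; split=> h; rewrite /ae_class /= => h1.
    by apply: filterS2 fg h1 => i /= <-.
  by apply: filterS2 fg h1 => i /= ->.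
rewrite /uclass; move: (ex_intro _ f _) (ex_intro _ g _).
by rewrite e => p q; congr Ultrapower; exact: Prop_irrelevance.
Qed.

Lemma ureprK (T : Type) (x : ultrapower F T) : uclass F (urepr x) = x.
Proof.
rewrite /urepr; case: cid => f /= fE; case: x fE => c p /= fE.
rewrite /uclass; move: (ex_intro _ f _); rewrite -fE => q.
by congr Ultrapower; exact: Prop_irrelevance.
Qed.

Lemma urepr_class (T : Type) (f : I -> T) :
  uf F [set i | urepr (uclass F f) i = f i].
Proof. by apply/uclassP; rewrite ureprK. Qed.

Lemma ulift1E (A B : Type) (f : A -> B) (x : I -> A) :
  ulift1 f (uclass F x) = uclass F (fun i => f (x i)).
Proof. by apply/uclassP; apply: filterS (urepr_class x) => i /= ->. Qed.

Lemma ulift2E (A B C : Type) (f : A -> B -> C) (x : I -> A) (y : I -> B) :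
  ulift2 f (uclass F x) (uclass F y) = uclass F (fun i => f (x i) (y i)).
Proof.
by apply/uclassP; apply: filterS2 (urepr_class x) (urepr_class y) => i /= -> ->.
Qed.

Lemma ulift_relE (A B : Type) (r : A -> B -> Prop) (x : I -> A) (y : I -> B) :
  ulift_rel r (uclass F x) (uclass F y) <-> uf F [set i | r (x i) (y i)].
Proof.
split; apply: filterS3 (urepr_class x) (urepr_class y) => i /= -> ->; exact.
Qed.

Lemma ultrapowerP (T : Type) (P : ultrapower F T -> Prop) :
  (forall f, P (uclass F f)) -> forall x, P x.
Proof. by move=> H x; rewrite -(ureprK x). Qed.

HB.instance Definition _ (T : Type) := gen_eqMixin (ultrapower F T).
HB.instance Definition _ (T : Type) := gen_choiceMixin (ultrapower F T).

Section Zmod.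
Context (T : zmodType).
Implicit Types x y z : ultrapower F T.
Let add x y := ulift2 +%R x y.
Let opp x := ulift1 -%R x.
Let zero := ucst F (0 : T).

Let addA : associative add.
Proof.
elim/ultrapowerP => x; elim/ultrapowerP => y; elim/ultrapowerP => z.
rewrite /add (ulift2E _ y) (ulift2E _ x y) !ulift2E.
by congr (uclass F _); apply/funext => i; rewrite addrA.
Qed.
Let addC : commutative add.
Proof.
elim/ultrapowerP => x; elim/ultrapowerP => y.
by rewrite /add !ulift2E; congr (uclass F _); apply/funext => i; rewrite addrC.
Qed.
Let add0 : left_id zero add.
Proof.
elim/ultrapowerP => x.
by rewrite /add !ulift2E; congr (uclass F _); apply/funext => i; rewrite add0r.
Qed.
Let addN : left_inverse zero opp add.
Proof.
elim/ultrapowerP => x.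
rewrite /add /opp ulift1E ulift2E; congr (uclass F _); apply/funext => i.
by rewrite addNr.
Qed.
HB.instance Definition _ :=
  GRing.isZmodule.Build (ultrapower F T) addA addC add0 addN.
End Zmod.

Section Ring.
Context (T : comNzRingType).
Implicit Types x y z : ultrapower F T.
Let mul x y := ulift2 *%R x y.
Let one := ucst F (1 : T).

Let mulA : associative mul.
Proof.
elim/ultrapowerP => x; elim/ultrapowerP => y; elim/ultrapowerP => z.
rewrite /mul (ulift2E _ y) (ulift2E _ x y) !ulift2E.
by congr (uclass F _); apply/funext => i; rewrite mulrA.
Qed.
Let mulC : commutative mul.
Proof.
elim/ultrapowerP => x; elim/ultrapowerP => y.
by rewrite /mul !ulift2E; congr (uclass F _); apply/funext => i; rewrite mulrC.
Qed.
Let mul1 : left_id one mul.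
Proof.
elim/ultrapowerP => x.
by rewrite /mul !ulift2E; congr (uclass F _); apply/funext => i; rewrite mul1r.
Qed.
Let mulD : left_distributive mul +%R.
Proof.
elim/ultrapowerP => x; elim/ultrapowerP => y; elim/ultrapowerP => z.
rewrite /mul /GRing.add /= (ulift2E _ x y) (ulift2E _ x z) (ulift2E _ y z).
rewrite !ulift2E; congr (uclass F _); apply/funext => i.
by rewrite mulrDl.
Qed.
Let one_neq0 : one != 0.
Proof.
apply/eqP => /uclassP /filter_ex[i /=]; apply/eqP; exact: oner_neq0.
Qed.
HB.instance Definition _ :=
  GRing.Zmodule_isComNzRing.Build (ultrapower F T) mulA mulC mul1 mulD one_neq0.
End Ring.

Section Field.
Context (T : fieldType).
Let inv (x : ultrapower F T) := ulift1 GRing.inv x.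
Let mulV (x : ultrapower F T) : x != 0 -> inv x * x = 1.
Proof.
elim/ultrapowerP: x => x /eqP x0.
rewrite /inv ulift1E /GRing.mul /= ulift2E; apply/uclassP.
have [xz|] := in_ultra_setVsetC [set i | x i = 0] (uf_ultra F).
  by exfalso; apply: x0; apply/uclassP.
by apply: filterS => i /eqP xi; rewrite /= mulVf.
Qed.
Let inv0 : inv 0 = 0.
Proof. by rewrite /inv /GRing.zero /= ulift1E invr0. Qed.
HB.instance Definition _ :=
  GRing.ComNzRing_isField.Build (ultrapower F T) mulV inv0.
End Field.

Section Order.
Context {d : Order.disp_t} (T : porderType d).
Let le (x y : ultrapower F T) := `[< ulift_rel (fun a b => (a <= b)%O) x y >].
Let le_refl : reflexive le.
Proof.
elim/ultrapowerP => x; apply/asboolP/ulift_relE.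
by apply: filterS filterT => i _ /=.
Qed.
Let le_anti : antisymmetric le.
Proof.
elim/ultrapowerP => x; elim/ultrapowerP => y.
move=> /andP[/asboolP/ulift_relE xy /asboolP/ulift_relE yx].
by apply/uclassP; apply: filterS2 xy yx => i /= h1 h2; apply/le_anti/andP.
Qed.
Let le_trans : transitive le.
Proof.
elim/ultrapowerP => y; elim/ultrapowerP => x; elim/ultrapowerP => z.
move=> /asboolP/ulift_relE xy /asboolP/ulift_relE yz.
apply/asboolP/ulift_relE; apply: filterS2 xy yz => i /=; exact: le_trans.
Qed.
HB.instance Definition _ :=
  Order.Le_isPOrder.Build d (ultrapower F T) le_refl le_anti le_trans.
End Order.

HB.instance Definition _ (T : porderZmodType) :=
  Order.POrder.on (ultrapower F T).

End UltrapowerTheory.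

(** The *-ultrapower of *T with respect to *F1 is the F2-extension of the
    ultrapower T^I1 / F1: its elements are the classes, modulo *F1, of the
    *-internal functions *I1 -> *T, that is, of the elements of *(T^I1). *)

Notation dpower F1 F2 T := (ultrapower F2 (ultrapower F1 T)).

Section Double.
Context {I1 I2 : Type} {F1 : npultrafilter I1} {F2 : npultrafilter I2}.
Local Notation st T := (ultrapower F2 T).
Local Notation dst T := (dpower F1 F2 T).

Definition star {T : Type} (x : st T) : dst T := ulift1 (@ucst I1 F1 T) x.

(** For a *-internal S, the classes modulo *F1 of the *-internal functions
    *I1 -> S. *)
Definition star_set (T : Type) (S : set (st T)) : set (dst T) :=
  [set ulift1 (@uclass I1 F1 T) phi | phi in
    [set phi : st (I1 -> T) |
      forall l : st I1, S (ulift2 (fun f x => f x) phi l)]].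

Definition dcst (T : Type) (x : T) : dst T := star (ucst F2 x).

Definition dlift1 (A B : Type) (f : A -> B) (x : dst A) : dst B :=
  ulift1 (ulift1 f) x.

Definition dlift2 (A B C : Type) (f : A -> B -> C) (x : dst A) (y : dst B) :
  dst C := ulift2 (ulift2 f) x y.

Definition dlift_rel (A B : Type) (r : A -> B -> Prop) (x : dst A) (y : dst B) :
  Prop := ulift_rel (ulift_rel r) x y.

Definition happ (A B : Type) (phi : dst (A -> B)) (x : dst A) : dst B :=
  dlift2 (fun f a => f a) phi x.

Definition hset (T : choiceType) (G : dst {fset T}) : set (dst T) :=
  [set x | dlift_rel (fun (a : T) (A : {fset T}) => a \in A) x G].

(** Internal hyperfinite iteration of op over the terms f k, k in S. The index
    set S is identified, along iota, with the internal hyperfinite set hset G,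
    and f with the restriction to it of the internal function phi; the value
    is then obtained by extending the standard finite iterations. It does not
    depend on the choice of G and phi (hbig_eq). The map iota is id when S
    consists of doubly internal objects, and star when S is a *-finite set:
    then star_set S = star @` S. *)
Definition hbig (J : Type) (T : choiceType) (V : Type) (op : V -> V -> V)
  (idx : V) (iota : J -> dst T) (S : set J) (f : J -> dst V) : dst V :=
  xget (dcst idx) [set y | exists (G : dst {fset T}) (phi : dst (T -> V)),
    [/\ hset G = iota @` S,
        forall k, S k -> f k = happ phi (iota k) &
        y = dlift2 (fun (A : {fset T}) (g : T -> V) =>
                      \big[op/idx]_(x <- A) g x) G phi]].

Definition hsum (J : Type) (T : choiceType) (V : zmodType) (iota : J -> dst T)
  (S : set J) (f : J -> dst V) : dst V := hbig +%R 0 iota S f.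

Definition hprod (J : Type) (T : choiceType) (V : comNzRingType)
  (iota : J -> dst T) (S : set J) (f : J -> dst V) : dst V :=
  hbig *%R 1 iota S f.

Definition hprodn (J : Type) (T : choiceType) (iota : J -> dst T) (S : set J)
  (f : J -> dst nat) : dst nat := hbig muln 1%N iota S f.

Definition dclass (T : Type) (f : I2 -> I1 -> T) : dst T :=
  uclass F2 (fun m => uclass F1 (f m)).

Definition dae (P : I2 -> I1 -> Prop) : Prop :=
  uf F2 [set m | uf F1 [set l | P m l]].

Lemma dclass_surj (T : Type) (x : dst T) : exists f, x = dclass f.
Proof.
exists (fun m => urepr (urepr x m)); rewrite -[LHS]ureprK.
by congr (uclass F2 _); apply/funext => m; rewrite ureprK.
Qed.

Lemma dclassP (T : Type) (f g : I2 -> I1 -> T) :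
  dclass f = dclass g <-> dae (fun m l => f m l = g m l).
Proof.
split=> [/uclassP|] h; last apply/uclassP;
  by apply: filterS h => m /uclassP.
Qed.

Lemma dlift1E (A B : Type) (f : A -> B) (x : I2 -> I1 -> A) :
  dlift1 f (dclass x) = dclass (fun m l => f (x m l)).
Proof.
rewrite /dlift1 /dclass (ulift1E _ _ (fun m => uclass F1 (x m))).
by congr (uclass F2 _); apply/funext => m; rewrite ulift1E.
Qed.

Lemma dlift2E (A B C : Type) (f : A -> B -> C) (x : I2 -> I1 -> A)
    (y : I2 -> I1 -> B) :
  dlift2 f (dclass x) (dclass y) = dclass (fun m l => f (x m l) (y m l)).
Proof.
rewrite /dlift2 /dclass.
rewrite (ulift2E _ _ (fun m => uclass F1 (x m)) (fun m => uclass F1 (y m))).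
by congr (uclass F2 _); apply/funext => m; rewrite ulift2E.
Qed.

Lemma dlift_relE (A B : Type) (r : A -> B -> Prop) (x : I2 -> I1 -> A)
    (y : I2 -> I1 -> B) :
  dlift_rel r (dclass x) (dclass y) <-> dae (fun m l => r (x m l) (y m l)).
Proof.
rewrite /dlift_rel /dclass.
split=> [/ulift_relE|] h; first by apply: filterS h => m /= /ulift_relE.
by apply/ulift_relE; apply: filterS h => m /= h; apply/ulift_relE.
Qed.

Lemma daeS (P Q : I2 -> I1 -> Prop) :
  (forall m l, P m l -> Q m l) -> dae P -> dae Q.
Proof.
by move=> PQ; apply: filterS => m; apply: filterS => l; exact: PQ.
Qed.

Lemma dae2 (P Q : I2 -> I1 -> Prop) :
  dae P -> dae Q -> dae (fun m l => P m l /\ Q m l).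
Proof. by apply: filterS2 => m; apply: filterS2. Qed.

Lemma dae_not (P : I2 -> I1 -> Prop) : ~ dae P -> dae (fun m l => ~ P m l).
Proof.
move=> nP; have [//|] :=
  in_ultra_setVsetC [set m | uf F1 [set l | P m l]] (uf_ultra F2).
apply: filterS => m /= nm.
by have [|] := in_ultra_setVsetC [set l | P m l] (uf_ultra F1).
Qed.

Lemma dae_false : ~ dae (fun _ _ => False).
Proof. by move=> /filter_ex[m /filter_ex[]]. Qed.

Lemma dae_ex (T : Type) (P : T -> I2 -> I1 -> Prop) (t0 : I2 -> I1 -> T) :
  dae (fun m l => exists t, P t m l) ->
  exists f : I2 -> I1 -> T, dae (fun m l => P (f m l) m l).
Proof.
have /choice[f fP] (ml : I2 * I1) :
    exists t, (exists t, P t ml.1 ml.2) -> P t ml.1 ml.2.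
  have [[t Pt]|nP] := pselect (exists t, P t ml.1 ml.2); first by exists t.
  by exists (t0 ml.1 ml.2) => /nP.
by move=> h; exists (fun m l => f (m, l)); apply: daeS h => m l /(fP (m, l)).
Qed.

Lemma in_hsetE (T : choiceType) (x : I2 -> I1 -> T) (G : I2 -> I1 -> {fset T}) :
  hset (dclass G) (dclass x) <-> dae (fun m l => x m l \in G m l).
Proof. exact: dlift_relE. Qed.

Lemma hset_wit (T : choiceType) (G : I2 -> I1 -> {fset T})
    (P : T -> I2 -> I1 -> Prop) :
  dae (fun m l => exists2 t, t \in G m l & P t m l) ->
  exists2 f : I2 -> I1 -> T,
    hset (dclass G) (dclass f) & dae (fun m l => P (f m l) m l).
Proof.
move=> h; have [m /filter_ex[l [t0 _ _]]] := filter_ex h.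
have [|f fP] := @dae_ex T (fun t m l => t \in G m l /\ P t m l) (fun _ _ => t0).
  by apply: daeS h => m' l' [t tG Pt]; exists t.
exists f; last by apply: daeS fP => ? ? [].
by apply/in_hsetE; apply: daeS fP => ? ? [].
Qed.

Lemma hset_sub (T : choiceType) (G G' : I2 -> I1 -> {fset T}) :
  hset (dclass G) `<=` hset (dclass G') ->
  dae (fun m l => {subset G m l <= G' m l}).
Proof.
move=> sGG'; apply: contrapT => /dae_not h.
have [|f fG fG'] := @hset_wit T G (fun t m l => t \notin G' m l).
  apply: daeS h => m l /existsNP[t /not_implyP[tG /negP tG']].
  by exists t.
apply: dae_false; have /in_hsetE := sGG' _ fG.
by move=> /(dae2 fG'); apply: daeS => m l [/negP].
Qed.

Lemma hset_inj (T : choiceType) : injective (@hset T).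
Proof.
move=> G G'; have [g ->] := dclass_surj G; have [g' ->] := dclass_surj G'.
move=> e; apply/dclassP.
have h1 : dae (fun m l => {subset g m l <= g' m l}).
  by apply: hset_sub; rewrite e.
have h2 : dae (fun m l => {subset g' m l <= g m l}).
  by apply: hset_sub; rewrite e.
apply: daeS (dae2 h1 h2) => m l [s1 s2]; apply/fsetP => t.
by apply/idP/idP => [/s1|/s2].
Qed.

Lemma hbig_eq (J : Type) (T : choiceType) (V : Type) (op : V -> V -> V)
  (idx : V) (iota : J -> dst T) (S : set J) (f : J -> dst V)
  (G : dst {fset T}) (phi : dst (T -> V)) :
  hset G = iota @` S -> (forall k, S k -> f k = happ phi (iota k)) ->
  hbig op idx iota S f =
    dlift2 (fun (A : {fset T}) (g : T -> V) => \big[op/idx]_(x <- A) g x) G phi.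
Proof.
move=> GS fphi; apply: xget_unique; first by exists G, phi.
move=> _ [G'] [psi] [G'S fpsi ->].
have -> : G' = G by apply: hset_inj; rewrite GS.
have {G' G'S}agree x : hset G x -> happ psi x = happ phi x.
  by rewrite GS => -[k Sk <-]; rewrite -fpsi // -fphi.
move: agree {GS fphi fpsi}; have [g ->] := dclass_surj G.
have [p ->] := dclass_surj phi; have [q ->] := dclass_surj psi => agree.
rewrite !dlift2E; apply/dclassP.
suff : dae (fun m l => forall t, t \in g m l -> q m l t = p m l t).
  by apply: daeS => m l qp; apply: eq_big_seq => t; exact: qp.
apply: contrapT => /dae_not h.
have [|t tg ne] := @hset_wit T g (fun t m l => q m l t <> p m l t).
  by apply: daeS h => m l /existsNP[t /not_implyP[tg ne]]; exists t.
have := agree _ tg; rewrite /happ !dlift2E => /dclassP eq.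
by apply: dae_false; apply: daeS (dae2 eq ne) => m l [].
Qed.

End Double.

Definition cexp (R : realType) (z : R[i]) : R[i] :=
  ((expR (complex.Re z))%:C * (cos (complex.Im z) +i* sin (complex.Im z)))%C.

Definition csinh (R : realType) (z : R[i]) : R[i] := (cexp z - cexp (- z)) / 2.

Lemma ex_next_prime (m : nat) : exists q, (m < q)%N && prime q.
Proof. by have [q mq pq] := prime_above m; exists q; rewrite mq. Qed.

Definition next_prime (m : nat) : nat := ex_minn (ex_next_prime m).

(** The primes are indexed from 1; the value at 0 is irrelevant. *)
Definition nth_prime (n : nat) : nat := iter n next_prime 0%N.

Lemma nth_prime1 : nth_prime 1 = 2.
Proof.
rewrite /= /next_prime; case: ex_minnP => q /andP[_ /prime_gt1 q1] /(_ 2%N isT).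
by move=> q2; apply/eqP; rewrite eqn_leq q2.
Qed.

Lemma nth_prime_prime (n : nat) : prime (nth_prime n.+1).
Proof. by rewrite /= /next_prime; case: ex_minnP => q /andP[]. Qed.

Lemma nth_prime_lt (n : nat) : (nth_prime n < nth_prime n.+1)%N.
Proof. by rewrite /= /next_prime; case: ex_minnP => q /andP[]. Qed.

Lemma nth_prime_onto (q : nat) : prime q -> exists n, nth_prime n.+1 = q.
Proof.
move=> pq; have pn n : (n <= nth_prime n)%N.
  by elim: n => // n IH; apply: leq_ltn_trans IH (nth_prime_lt n).
have ex : exists n, (q <= nth_prime n)%N by exists q.
case: (ex_minnP ex) => -[|n] qn nmin; first by move: qn pq; case: q {ex nmin}.
exists n; apply/eqP; rewrite eqn_leq qn andbT.
have nq : (nth_prime n < q)%N.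
  by rewrite ltnNge; apply/negP => /nmin; rewrite ltnn.
by rewrite /= /next_prime; case: ex_minnP => r _; apply; rewrite nq.
Qed.

Section Functionals.
Context {R : realType} {I1 I2 : Type}.
Context {F1 : npultrafilter I1} {F2 : npultrafilter I2}.
Local Notation st T := (ultrapower F2 T).
Local Notation dst T := (dpower F1 F2 T).
Local Notation C := (R[i]).

Definition hR (z : st int) : st R := ulift1 (fun m : int => m%:~R) z.
Definition dR (z : dst int) : dst R := dlift1 (fun m : int => m%:~R) z.
Definition dC (x : dst R) : dst C := dlift1 (fun r : R => r%:C%C) x.

Definition hexp (z : dst C) : dst C := dlift1 (@cexp R) z.
Definition hsinh (z : dst C) : dst C := dlift1 (@csinh R) z.
Definition hlog (q : dst nat) : dst R :=
  dlift1 (fun n : nat => ln (n%:R : R)) q.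
Definition hnorm (z : dst C) : dst C := dlift1 (fun x : C => `|x|) z.

Definition hpow (q : dst nat) (z : dst C) : dst C := hexp (z * dC (hlog q)).

Definition hlim (f : dst C -> dst C) (w : dst C) : dst C :=
  xget 0 [set l | forall e : dst C, 0 < e -> exists2 d : dst C, 0 < d &
    forall z, z != w -> hnorm (z - w) < d -> hnorm (f z - l) < e].

(** N w / D w, with the value at a removable singularity given by the limit:
    division by 0 is total and would return 0 there. *)
Definition hquot (N D : dst C -> dst C) (w : dst C) : dst C :=
  if D w == 0 then hlim (fun z => N z / D z) w else N w / D w.

Section Lattices.
Context (H : st int) (H' : dst int).

Definition eps : st R := (hR H)^-1.
Definition eps' : dst R := (dR H')^-1.

Definition L : set (st R) := [set x | exists z : st int,
  x = eps * hR z /\ - (hR H / 2) <= x < hR H / 2].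

Definition L' : set (dst R) := [set x | exists z : dst int,
  x = eps' * dR z /\ - (dR H' / 2) <= x < dR H' / 2].

(** Internal functions with hyperfinite domain are the elements of the extension
    of the set of finite functions; L being hyperfinite, this covers all the
    internal functions with domain star_set L. *)
Local Notation ifun := (dst {fmap R -> R}).

Definition idom (a : ifun) : set (dst R) :=
  hset (dlift1 (fun g : {fmap R -> R} => domf g) a).

Definition ival (a : ifun) (k : dst R) : dst R :=
  dlift2 (fun (g : {fmap R -> R}) (x : R) => odflt 0 g.[? x]%fmap) a k.

Definition X : set ifun :=
  [set a | idom a = star_set L /\ forall k, star_set L k -> L' (ival a k)].

(** The values of f outside X are irrelevant. *)
Definition A : set (ifun -> dst C) := [set f |
  exists phi : dst ({fmap R -> R} -> C), forall a, X a -> f a = happ phi a].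

Definition eps0 : dst R :=
  dlift2 (fun (x : R) (m : int) => x ^ m) (dR H') (- (star H) ^+ 2).

Definition two_pi_i : dst C := dcst (0 +i* (2 * pi))%C.

Definition fourier (f : ifun -> dst C) (b : ifun) : dst C :=
  hsum id X (fun a =>
    dC eps0 *
    hexp (- two_pi_i *
      dC (hsum star L (fun k => ival a (star k) * ival b (star k)))) * f a).

Definition ptilde (l : st nat) : dst nat := star (ulift1 nth_prime l).

(** For k in L the argument of truncn is a hypernatural number, so that the
    truncation only changes its type. *)
Definition q_ (k : st R) : dst nat :=
  ptilde (ulift1 (fun x : R => Num.truncn x) (hR H * (k + hR H / 2) + 1)).

Definition Z_ (s : C) (a : ifun) : dst C :=
  hprod star L (fun k =>
    hpow (q_ k) (- dcst s * dC (ival a (star k) + dR H' / 2))).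

Definition w_ (s : C) (b : ifun) (k : st R) : dst C :=
  two_pi_i * dC (ival b (star k)) + dcst s * dC (hlog (q_ k)).

End Lattices.
End Functionals.

(* Main.v *)
Require Import Defs.
From HB Require Import structures.
From mathcomp Require Import all_boot all_order all_algebra finmap.
From mathcomp Require Import complex.
From mathcomp Require Import all_classical reals topology normedtype sequences.
From mathcomp Require Import exp trigo.
From mathcomp Require Import ring lra.

Set Implicit Arguments.
Unset Strict Implicit.
Unset Printing Implicit Defensive.

Import Order.TTheory GRing.Theory Num.Theory.
Import numFieldNormedType.Exports.
Local Open Scope classical_set_scope.
Local Open Scope ring_scope.

(** By transfer everything reduces to finite sums. Choosing representatives of
    [H] and [H'], the set [L] becomes a family of finite grids and [X] a family
    of finite sets of functions between grids. Over a finite function set the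
    sum of products is a product of sums, and as [#|L| = H ^ 2] the factor
    [eps0] supplies one [eps'] per factor; each factor is then a geometric sum
    with ratio [exp (- eps' w)]. Where its denominator vanishes, the closed form
    is a limit, which equals the finite sum itself because that sum is
    continuous in [w] and the zeros of the denominator are isolated. *)

(** * Complex exponential *)

Section ComplexExponential.
Context {R : realType}.
Implicit Types (z w u : R[i]) (x y e : R).

Lemma cexp0 : cexp 0 = 1 :> R[i].
Proof.
by rewrite /cexp /= expR0 cos0 sin0; apply/eqP; rewrite eq_complex /=;
  apply/andP; split; apply/eqP; ring.
Qed.

Lemma cexpD z w : cexp (z + w) = cexp z * cexp w.
Proof.
case: z w => [a b] [c d]; rewrite /cexp /= expRD cosD sinD.
by apply/eqP; rewrite eq_complex /=; apply/andP; split; apply/eqP; ring.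
Qed.

Lemma cexp_neq0 z : cexp z != 0.
Proof.
apply/eqP => z0; have := cexp0; rewrite -(subrr z) cexpD z0 mul0r => /esym/eqP.
by rewrite oner_eq0.
Qed.

Lemma cexpN z : cexp (- z) = (cexp z)^-1.
Proof.
apply: (mulfI (cexp_neq0 z)).
by rewrite -cexpD subrr cexp0 divff // cexp_neq0.
Qed.

Lemma cexp_sum (I : Type) (r : seq I) (f : I -> R[i]) :
  cexp (\sum_(i <- r) f i) = \prod_(i <- r) cexp (f i).
Proof.
by apply: (big_morph (@cexp R)) => [z w|]; [exact: cexpD|exact: cexp0].
Qed.

Lemma cexpMn z n : cexp (z *+ n) = cexp z ^+ n.
Proof.
by elim: n => [|n IH]; rewrite ?mulr0n ?cexp0 // mulrS exprS cexpD IH.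
Qed.

(** Multiply [cexp z = cexp (- z)] by the nonzero [cexp z]. Zeros of the denominator thus become
    solutions of [cexp u = 1]. *)
Lemma csinh_eq0 z : (csinh z == 0) = (cexp (z *+ 2) == 1).
Proof.
rewrite /csinh mulf_eq0 invr_eq0 pnatr_eq0 orbF cexpN subr_eq0 cexpMn.
rewrite -(inj_eq (mulIf (cexp_neq0 z))) mulVf ?cexp_neq0 //.
Qed.

Lemma natr_complex (n : nat) : n%:R = n%:R%:C%C :> R[i].
Proof. by rewrite rmorph_nat. Qed.

Lemma normc_le_ReIm z :
  `|z| <= (`|complex.Re z| + `|complex.Im z|)%:C%C.
Proof.
rewrite {1}[z]complexE (le_trans (ler_normD _ _)) // normrM.
have -> : `|('i%C : R[i])| = 1.
  by rewrite normc_def /= expr0n expr1n add0r sqrtr1.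
by rewrite mul1r !normc_def /= expr0n !addr0 !sqrtr_sqr -rmorphD.
Qed.

(** Up to sign the imaginary part is the real part of [z * 'i], which has the same modulus as
    [z]. *)
Lemma normc_ge_Im z : (`|complex.Im z|%:C)%C <= `|z|.
Proof.
rewrite -[X in `|X|](opprK) -ReiNIm normrN.
by rewrite (le_trans (normc_ge_Re _)) // normrM [X in _ * X]normc_def /=
  expr0n expr1n add0r sqrtr1 mulr1.
Qed.

Lemma cexp_near1 e : 0 < e ->
  exists2 d : R, 0 < d & forall u, `|u| < d%:C%C -> `|cexp u - 1| < e%:C%C.
Proof.
(* If [expR], [cos] and [sin] each move by less than [t <= 1], the real part of [cexp u - 1] is
   below [3 * t] and the imaginary part at most [2 * t], in total below [5 * t <= e]. *)
move=> e0; set t := Num.min 1 (e / 5).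
have t0 : 0 < t by rewrite lt_min ltr01 divr_gt0.
have near (f : R -> R) : continuous f ->
    exists2 d : R, 0 < d & forall x, `|x| < d -> `|f 0 - f x| < t.
  move=> /(_ 0) /cvgrPdist_lt /(_ t t0) /nbhs_normP[d /= d0 fd].
  by exists d => // x xd; apply: fd; rewrite /= sub0r normrN.
have [d1 d10 h1] := near _ (@continuous_expR R).
have [d2 d20 h2] := near _ (@continuous_cos R).
have [d3 d30 h3] := near _ (@continuous_sin R).
exists (Num.min d1 (Num.min d2 d3)); first by rewrite !lt_min d10 d20 d30.
move=> u ud.
have := le_lt_trans (normc_ge_Re u) ud; rewrite ltcR !lt_min => /and3P[a1 _ _].
have := le_lt_trans (normc_ge_Im u) ud; rewrite ltcR !lt_min => /and3P[_ b2 b3].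
apply: le_lt_trans (normc_le_ReIm _) _; rewrite ltcR.
move: (h1 _ a1) (h2 _ b2) (h3 _ b3); rewrite expR0 cos0 sin0 sub0r.
have := expR_gt0 (complex.Re u).
case: u {ud a1 b2 b3} => a b /=; rewrite /cexp /=.
move: (expR a) (cos b) (sin b) => E c s E0; rewrite !mul0r subr0 addr0 oppr0 addr0.
have : t <= 1 by rewrite ge_min lexx.
have : t <= e / 5 by rewrite ge_min lexx orbT.
rewrite !ltr_norml => te t1 /andP[E1 E2] /andP[c1 c2] /andP[s1 s2].
have h : `|E * c - 1| < 3 * t by rewrite ltr_norml; apply/andP; split; nra.
have h' : `|E * s| <= 2 * t by rewrite ler_norml; apply/andP; split; nra.
lra.
Qed.

(** The imaginary part lies in [(-1, 1)], hence in [(- pi, pi)], where [sin] vanishes only at [0];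
    the real exponential then forces the real part to be [0]. This isolates the zeros of the
    denominator. *)
Lemma cexp_eq1_near0 u : cexp u = 1 -> `|u| < 1 -> u = 0.
Proof.
move=> /eqP; rewrite eq_complex /cexp /= !mul0r subr0 addr0.
move=> /andP[/eqP h1 /eqP h2] u1; have := le_lt_trans (normc_ge_Im u) u1.
rewrite (ltcR _ 1); case: u h1 h2 {u1} => a b /= h1 h2 b1.
have sb : sin b = 0.
  by move/eqP: h2; rewrite mulf_eq0 gt_eqF ?expR_gt0 //= => /eqP.
have p1 : 1 < (pi : R) by have := pi_ge2 R; lra.
have b0 : b = 0.
  move: b1; rewrite ltr_norml => /andP[bN bP].
  have [b0|b0|//] := ltrgtP b 0.
    have : 0 < sin (- b) by apply: sin_gt0_pi; lra.
    by rewrite sinN sb oppr0 ltxx.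
  have : 0 < sin b by apply: sin_gt0_pi; lra.
  by rewrite sb ltxx.
have : expR a = expR 0 by move: h1; rewrite b0 cos0 mulr1 expR0.
by move/expR_inj => ->; rewrite b0.
Qed.

Lemma cexp_sum_near (r : seq R) w e : 0 < e ->
  exists2 d : R, 0 < d & forall z, `|z - w| < d%:C%C ->
    `|\sum_(x <- r) cexp (- x%:C%C * z) - \sum_(x <- r) cexp (- x%:C%C * w)|
      < e%:C%C.
Proof.
elim: r e => [|x r IH] e e0.
  by exists 1 => // z _; rewrite !big_nil subrr normr0 ltcR.
have e20 : 0 < e / 2 by rewrite divr_gt0.
have [d1 d10 h1] := IH _ e20.
(* The increment of the head term is [cexp (- x * w)] times [cexp (- x * (z - w)) - 1], so
   continuity at [0] suffices, with the tolerance divided by the modulus [k] of the first factor. *)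
have [k k0 kE] : exists2 k : R, 0 < k & `|cexp (- x%:C%C * w)| = k%:C%C.
  have := cexp_neq0 (- x%:C%C * w); rewrite -normr_gt0 normc_def ltcR => k0.
  by eexists; first exact: k0.
have [d2 d20 h2] := cexp_near1 (divr_gt0 e20 k0).
(* Adding [1] keeps the bound on [z - w] meaningful when [x = 0]. *)
have x1 : 0 < `|x| + 1 by rewrite ltr_wpDl.
exists (Num.min d1 (d2 / (`|x| + 1))).
  by rewrite lt_min d10 divr_gt0.
move=> z zw; rewrite !big_cons opprD addrACA.
have -> : e%:C%C = (e / 2)%:C%C + (e / 2)%:C%C by rewrite -rmorphD -splitr.
apply: le_lt_trans (ler_normD _ _) _; apply: ltrD; last first.
  by apply: h1; apply: lt_le_trans zw _; rewrite lecR ge_min lexx.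
have -> : cexp (- x%:C%C * z) - cexp (- x%:C%C * w) =
    cexp (- x%:C%C * w) * (cexp (- x%:C%C * (z - w)) - 1).
  by rewrite mulrBr mulr1 -cexpD; congr (cexp _ - _); ring.
rewrite normrM kE.
have -> : (e / 2)%:C%C = k%:C%C * (e / 2 / k)%:C%C.
  by rewrite -rmorphM mulrCA divff ?mulr1 // gt_eqF.
have kC : 0 < k%:C%C by rewrite ltcR.
rewrite (ltr_pM2l kC); apply: h2; rewrite mulNr normrN normrM.
have -> : `|x%:C%C| = `|x|%:C%C by rewrite normc_def /= expr0n addr0 sqrtr_sqr.
have [zr zrE] : exists t : R, `|z - w| = t%:C%C.
  by rewrite normc_def; eexists.
have zr0 : 0 <= zr by rewrite -lecR -zrE normr_ge0.
rewrite zrE -rmorphM ltcR; move: zw; rewrite zrE ltcR lt_min => /andP[_ zd].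
have : zr * (`|x| + 1) < d2 by rewrite -ltr_pdivlMr.
apply: le_lt_trans; rewrite mulrC ler_wpM2l // lerDl //.
Qed.

End ComplexExponential.

(** * Lattices *)

Section Grid.
Context {R : realType}.

(** Finite counterpart of [L] and [L'], for even [N]. Enumerating it by [i < N * N] makes its
    cardinality visible and turns exponential sums over it into geometric sums in [i]. *)
Definition grid (N : nat) : {fset R} :=
  [fset N%:R^-1 * ((nat_of_ord i)%:R - (N * N)%:R / 2) | i : 'I_(N * N)]%fset.

Lemma grid_inj (N : nat) : (0 < N)%N ->
  injective (fun i : 'I_(N * N) => N%:R^-1 * (i%:R - (N * N)%:R / 2) : R).
Proof.
move=> N0 i j; have N0R : (N%:R : R)^-1 != 0.
  by rewrite invr_eq0 pnatr_eq0 -lt0n.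
move=> /(mulfI N0R) /addIr /eqP; rewrite eqr_nat => /eqP ij; exact: val_inj.
Qed.

Lemma big_grid (V : Type) (idx : V) (op : Monoid.com_law idx) (N : nat)
    (f : R -> V) : (0 < N)%N ->
  \big[op/idx]_(x <- grid N) f x =
  \big[op/idx]_(i < N * N) f (N%:R^-1 * (i%:R - (N * N)%:R / 2)).
Proof.
move=> N0; rewrite big_imfset /=; first by rewrite big_enum.
by move=> i j _ _; exact: grid_inj.
Qed.

(** Since [N] is even, the offset [N * N / 2 = 2 * n.+1 ^ 2] is an integer, so shifting by it
    matches the indices [i < N * N] with the admissible integers [z]. *)
Lemma gridP (n : nat) (x : R) (N := n.+1.*2) :
  x \in grid N <-> exists z : int,
    x = N%:R^-1 * z%:~R /\ - (N%:R / 2) <= x < N%:R / 2.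
Proof.
have NE : N%:R = 2 * (n.+1)%:R :> R by rewrite /N -muln2 natrM mulrC.
have n0 : 0 < (n.+1)%:R :> R by rewrite ltr0n.
have N0 : 0 < N%:R :> R by rewrite NE mulr_gt0.
have bnd (y : R) : (- (N%:R / 2) <= N%:R^-1 * y < N%:R / 2) =
    (- (2 * (n.+1)%:R ^+ 2) <= y < 2 * (n.+1)%:R ^+ 2).
  rewrite [_ * y]mulrC ler_pdivlMr // ltr_pdivrMr // NE.
  by congr (_ && _); congr (_ _ _); field.
have half : (N * N)%:R / 2 = (2 * n.+1 ^ 2)%:R :> R.
  by rewrite natrM NE natrM natrX; field.
split.
  move=> /imfsetP[i _ ->].
  exists (i%:Z - (2 * n.+1 ^ 2)%:Z); rewrite bnd half intrB /=; split=> //.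
  have iN : i%:R < 4 * n.+1%:R ^+ 2 :> R.
    have : i%:R < (N * N)%:R :> R by rewrite ltr_nat.
    by rewrite natrM NE; lra.
  have i0 : 0 <= i%:R :> R by [].
  by rewrite natrM natrX; apply/andP; split; nra.
move=> [z [->]]; rewrite bnd => /andP[z1 z2].
have zz1 : (0 <= z + (2 * n.+1 ^ 2)%:Z)%R.
  rewrite -(ler_int R) intrD /= [X in _ + X]natrM natrX; lra.
have [k kE] : exists k : nat, z + (2 * n.+1 ^ 2)%:Z = k%:Z.
  by exists (absz (z + (2 * n.+1 ^ 2)%:Z)); rewrite gez0_abs.
have kR : k%:R = z%:~R + (2 * n.+1 ^ 2)%:R :> R.
  by rewrite -[LHS]/((k%:Z)%:~R) -kE intrD.
have kN : (k < N * N)%N.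
  rewrite -(ltr_nat R) kR natrM natrM natrX NE; nra.
apply/imfsetP; exists (Ordinal kN) => //=; rewrite half kR; congr (_ * _); ring.
Qed.

Lemma prod_grid_const (V : comPzRingType) (c : V) (N : nat) : (0 < N)%N ->
  \prod_(x <- grid N) c = c ^+ (N * N).
Proof. by move=> N0; rewrite big_grid // prodr_const card_ord. Qed.

(* Multiplied out, so that it also holds where the denominator vanishes. *)
Lemma grid_geom_sum (N : nat) (w : R[i]) : (0 < N)%N ->
  (\sum_(x <- grid N) cexp (- x%:C%C * w)) *
  (cexp (- (N%:R^-1 / 2)%:C%C * w) * csinh ((N%:R^-1 / 2)%:C%C * w)) =
  csinh (w * (N%:R / 2)%:C%C).
Proof.
move=> N0; have N0R : (N%:R : R) != 0 by rewrite pnatr_eq0 -lt0n.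
rewrite big_grid //; set v := (N%:R^-1 / 2)%:C%C * w.
have v2 : (N%:R^-1)%:C%C * w = v *+ 2.
  by rewrite /v mulr2n -mulrDl -rmorphD /=; congr (_%:C%C * _); field.
have vN : w * (N%:R / 2)%:C%C = v *+ (N * N).
  rewrite -[v *+ _]mulr_natr natr_complex /v mulrAC -rmorphM mulrC.
  by congr (_%:C%C * _); rewrite natrM; field.
(* The grid starts at [- N / 2] and has step [1 / N]: the first term is [cexp v ^+ (N * N)] and the
   ratio is [cexp (- (v *+ 2))]. *)
have term (i : 'I_(N * N)) :
    cexp (- (N%:R^-1 * (i%:R - (N * N)%:R / 2))%:C%C * w) =
    cexp v ^+ (N * N) * cexp (- (v *+ 2)) ^+ i.
  rewrite -!cexpMn -cexpD -v2 -vN; congr cexp.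
  rewrite -[X in _ = _ + X]mulr_natr. rewrite natr_complex.
  have -> : N%:R / 2 = N%:R^-1 * ((N * N)%:R / 2) :> R by rewrite natrM; field.
  rewrite !rmorphM rmorphB !rmorphM /=; ring.
under eq_bigr do rewrite term.
rewrite -mulr_sumr vN mulNr -/v; set q := cexp (- (v *+ 2)).
(* The denominator is half of [1 - q], exactly the factor that telescopes the geometric sum. *)
have -> : cexp (- v) * csinh v = (1 - q) / 2.
  rewrite /csinh mulrA; congr (_ / _).
  by rewrite mulrBr -!cexpD addNr cexp0 /q mulr2n opprD.
rewrite /csinh mulrA; congr (_ / _); rewrite -mulrA.
have -> : (\sum_(i < N * N) q ^+ i) * (1 - q) = 1 - q ^+ (N * N).
  by rewrite mulrC -[1 - q]opprB mulNr -subrX1 opprB.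
rewrite mulrBr mulr1 cexpMn; congr (_ - _).
rewrite -exprMn /q -cexpD -cexpMn; congr cexp.
by rewrite mulr2n opprD addrA subrr sub0r mulNrn.
Qed.

End Grid.

(** * Finite sets of finite maps and distributivity *)

Section FiniteFunctions.
Context {K V : choiceType}.

(** Taken as an image of the finite type [{ffun D -> E}], so that sums over it can be moved there,
    while its elements keep the type [{fmap K -> V}], which is independent of [D] and [E] and hence
    can be used in an ultrapower. *)
Definition ffmaps (D : {fset K}) (E : {fset V}) : {fset {fmap K -> V}} :=
  [fset ([fmap x : D => val ((f : {ffun D -> E}) x)] : {fmap K -> V})
    | f : {ffun D -> E}]%fset.

Lemma ffmapsP (D : {fset K}) (E : {fset V}) (v0 : V) (g : {fmap K -> V}) :
  g \in ffmaps D E <->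
  domf g = D /\ forall x, x \in D -> odflt v0 g.[? x]%fmap \in E.
Proof.
split.
  move=> /imfsetP[f _ ->]; split=> // x xD.
  by rewrite (in_fnd xD) /= ffunE; exact: valP.
move=> [gD gE]; case: g gD gE => D' g /= eD; subst D' => gE.
have gE' (x : D) : g x \in E.
  have := gE _ (valP x); rewrite (in_fnd (valP x : val x \in domf (FinMap g))) /=.
  by rewrite (_ : [` _]%fset = x) //; exact: val_inj.
apply/imfsetP; exists [ffun x : D => [` gE' x]%fset] => //.
by congr FinMap; apply/ffunP => x; rewrite !ffunE.
Qed.

Lemma fnd_fmapval (D : {fset K}) (E : {fset V}) (f : {ffun D -> E}) (x : D) :
  [fmap y : D => val (f y)].[? val x]%fmap = Some (val (f x)).
Proof.
rewrite (in_fnd (valP x : val x \in domf [fmap y : D => val (f y)])) /=.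
by rewrite ffunE (_ : [` _]%fset = x) //; exact: val_inj.
Qed.

(** General distributivity [bigA_distr_bigA], carried along the injection of [{ffun D -> E}] into
    finite maps. This is what factors the Fourier sum over the points of the lattice. *)
Lemma sum_ffmaps_prod (S : comPzRingType) (D : {fset K}) (E : {fset V}) (v0 : V)
    (f : K -> V -> S) :
  \sum_(g <- ffmaps D E) \prod_(x <- D) f x (odflt v0 g.[? x]%fmap) =
  \prod_(x <- D) \sum_(y <- E) f x y.
Proof.
rewrite big_imfset /=; last first.
  move=> g h _ _ gh; apply/ffunP => x; apply/val_inj/Some_inj.
  by rewrite -!fnd_fmapval gh.
rewrite big_enum /= big_seq_fsetE /=.
under [RHS]eq_bigr do rewrite big_seq_fsetE /=.
rewrite bigA_distr_bigA /=; apply: eq_bigr => g _.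
rewrite big_seq_fsetE /=; apply: eq_bigr => x _.
by rewrite fnd_fmapval.
Qed.

End FiniteFunctions.


(** * The Fourier transform over finite grids *)

Section FiniteTransform.
Context {R : realType}.

(** Away from zeros of the denominator the quotient is the exponential sum, by [grid_geom_sum], and
    that sum is continuous. If [z] and [w] are both zeros, then [cexp ((z - w) / N) = 1], which for
    [z] within distance [1] of [w] gives [z = w]. *)
Lemma grid_quot_lim (N : nat) (w e : R[i]) : (0 < N)%N -> 0 < e ->
  cexp (- (N%:R^-1 / 2)%:C%C * w) * csinh ((N%:R^-1 / 2)%:C%C * w) = 0 ->
  exists2 d : R[i], 0 < d & forall z, z != w -> `|z - w| < d ->
    `|csinh (z * (N%:R / 2)%:C%C) /
       (cexp (- (N%:R^-1 / 2)%:C%C * z) * csinh ((N%:R^-1 / 2)%:C%C * z)) -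
      \sum_(x <- grid N) cexp (- x%:C%C * w)| < e.
Proof.
(* In the partial order of [R[i]], a positive element is real. *)
move=> N0 e0 Dw0; have eE : e = (complex.Re e)%:C%C.
  by rewrite RRe_real // ger0_real // ltW.
have [|d d0 dP] := @cexp_sum_near R (grid N) w (complex.Re e).
  by rewrite -ltcR -eE.
exists (Num.min d 1)%:C%C; first by rewrite ltcR lt_min d0 ltr01.
move=> z zw zd.
have zd1 : `|z - w| < d%:C%C by apply: lt_le_trans zd _; rewrite lecR ge_min lexx.
have zd2 : `|z - w| < 1.
  by apply: lt_le_trans zd _; rewrite (lecR _ 1) ge_min lexx orbT.
rewrite -grid_geom_sum // mulfK; first by rewrite eE; exact: dP.
apply: contra zw; rewrite mulf_eq0 (negPf (cexp_neq0 _)) csinh_eq0 /= => /eqP Dz.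
move/eqP: Dw0; rewrite mulf_eq0 (negPf (cexp_neq0 _)) csinh_eq0 /= => /eqP Dw.
have c2 (u : R[i]) : ((N%:R^-1 / 2)%:C%C * u) *+ 2 = (N%:R^-1)%:C%C * u.
  by rewrite mulr2n -mulrDl -rmorphD /=; congr (_%:C%C * _); field;
    rewrite pnatr_eq0 -lt0n.
have /cexp_eq1_near0 : cexp ((N%:R^-1)%:C%C * (z - w)) = 1 :> R[i].
  by rewrite mulrBr cexpD cexpN -!c2 Dz Dw divff ?oner_eq0.
have NC : (N%:R^-1)%:C%C = N%:R^-1 :> R[i] by rewrite natr_complex -fmorphV.
rewrite NC normrM normfV normr_nat => h.
have /eqP : N%:R^-1 * (z - w) = 0.
  apply: h; apply: le_lt_trans zd2; rewrite ler_piMl // invf_le1 ?ltr0n //.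
  by rewrite ler1n.
by rewrite mulf_eq0 invr_eq0 pnatr_eq0 gtn_eqF //= subr_eq0.
Qed.

Lemma ln_prod_nat (r : seq R) (q : R -> nat) :
  (forall x, x \in r -> (0 < q x)%N) ->
  ln ((\prod_(x <- r) q x)%N)%:R = \sum_(x <- r) ln (q x)%:R :> R.
Proof.
elim: r => [|x r IH] q0; first by rewrite !big_nil ln1.
have qr y : y \in r -> (0 < q y)%N by move=> yr; rewrite q0 // inE yr orbT.
rewrite !big_cons natrM lnM ?IH // posrE ltr0n ?q0 ?mem_head //.
by rewrite big_seq prodn_cond_gt0.
Qed.

(** The whole computation at a single pair of indices. Each summand is a product over [k] of factors
    depending on [a] only through its value at [k], so the sum over functions splits. *)
Lemma fourier_grid (N M : nat) (q : R -> nat) (b : R -> R) (c s : R[i]) :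
  (0 < N)%N -> (0 < M)%N -> (forall x, x \in grid N -> (0 < q x)%N) ->
  \sum_(a <- ffmaps (grid N) (grid M))
    ((M%:R ^ (- (N%:Z) ^+ 2))%:C%C *
     cexp (- c * (\sum_(k <- grid N) odflt 0 a.[? k]%fmap * b k)%:C%C) *
     \prod_(k <- grid N)
       cexp (- s * (odflt 0 a.[? k]%fmap + M%:R / 2)%:C%C * (ln (q k)%:R)%:C%C))
  = cexp (- s * (M%:R / 2)%:C%C * (ln ((\prod_(k <- grid N) q k)%N)%:R)%:C%C) *
    \prod_(k <- grid N) ((M%:R^-1)%:C%C *
      \sum_(x <- grid M)
        cexp (- x%:C%C * (c * (b k)%:C%C + s * (ln (q k)%:R)%:C%C))).
Proof.
(* [B k] is the contribution of the shift [M / 2], which does not depend on [a]; together these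
   factors form the power of the product of the [q k]. *)
move=> N0 M0 q0; set B := fun k => cexp (- s * (M%:R / 2)%:C%C * (ln (q k)%:R)%:C%C).
have -> : cexp (- s * (M%:R / 2)%:C%C *
    (ln ((\prod_(k <- grid N) q k)%N)%:R)%:C%C) = \prod_(k <- grid N) B k.
  by rewrite ln_prod_nat // rmorph_sum mulr_sumr cexp_sum.
(* The right side is expanded back into a sum over functions, which leaves a comparison of single
   factors. *)
rewrite -big_split /=; under [RHS]eq_bigr do rewrite mulrA mulr_sumr.
rewrite -(sum_ffmaps_prod _ _ 0); apply: eq_bigr => a _.
(* The grid has [N * N] points, so this power is one factor [M^-1] per point. *)
have -> : (M%:R ^ (- (N%:Z) ^+ 2))%:C%C = 
    \prod_(k <- (grid N : {fset R})) ((M%:R : R)^-1)%:C%C.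
  rewrite prod_grid_const // -(rmorphXn (real_complex R)) /=; congr (_%:C%C).
  by rewrite expr2 -PoszM -exprnN exprVn.
rewrite rmorph_sum mulr_sumr cexp_sum -!big_split /=; apply: eq_bigr => k _.
rewrite /B; set x := odflt _ _.
rewrite -mulrA -cexpD mulrAC -cexpD mulrC; congr (cexp _ * _).
rewrite rmorphD rmorphM /=; ring.
Qed.

End FiniteTransform.

(** * Transfer *)

Section Ultrapower.
Context {I : Type} (F : npultrafilter I).

Lemma uclassD (T : zmodType) (f g : I -> T) :
  uclass F f + uclass F g = uclass F (fun i => f i + g i).
Proof. exact: ulift2E. Qed.

Lemma uclassN (T : zmodType) (f : I -> T) :
  - uclass F f = uclass F (fun i => - f i).
Proof. exact: ulift1E. Qed.

Lemma uclassM (T : comNzRingType) (f g : I -> T) :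
  uclass F f * uclass F g = uclass F (fun i => f i * g i).
Proof. exact: ulift2E. Qed.

Lemma uclassV (T : fieldType) (f : I -> T) :
  (uclass F f)^-1 = uclass F (fun i => (f i)^-1).
Proof. exact: ulift1E. Qed.

Lemma uclass1 (T : comNzRingType) : 1 = uclass F (fun=> 1 : T).
Proof. by []. Qed.

Lemma uclass2 (T : comNzRingType) : 2 = uclass F (fun=> 2 : T).
Proof. by rewrite mulr2n; exact: uclassD. Qed.

Lemma uclass_neq (T : Type) (f g : I -> T) :
  uclass F f <> uclass F g <-> uf F [set i | f i <> g i].
Proof.
split=> [fg|fg /uclassP h].
  have [h|//] := in_ultra_setVsetC [set i | f i = g i] (uf_ultra F).
  by exfalso; apply/fg/uclassP.
have : uf F set0 by apply: filterS2 fg h.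
by move/filter_ex => -[].
Qed.

Lemma uclass_le (d : Order.disp_t) (T : porderType d) (f g : I -> T) :
  (uclass F f <= uclass F g)%O <-> uf F [set i | (f i <= g i)%O].
Proof.
split=> [/asboolP/ulift_relE //|h]; by apply/asboolP/ulift_relE.
Qed.

Lemma uclass_lt (d : Order.disp_t) (T : porderType d) (f g : I -> T) :
  (uclass F f < uclass F g)%O <-> uf F [set i | (f i < g i)%O].
Proof.
split.
  rewrite lt_neqAle => /andP[/eqP/uclass_neq h1 /uclass_le h2].
  by apply: filterS2 h1 h2 => i /= /eqP ? ?; rewrite lt_neqAle; apply/andP.
move=> h; rewrite lt_neqAle; apply/andP; split.
  by apply/eqP/uclass_neq; apply: filterS h => i /= + e; rewrite e ltxx.
by apply/uclass_le; apply: filterS h => i /= /ltW.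
Qed.

(** An ultrafilter selects one cell of a finite partition: either the head of [r] is the value
    almost everywhere, or the value almost everywhere lies in the tail. *)
Lemma uf_mem_seq (T : eqType) (r : seq T) (f : I -> T) :
  uf F [set i | f i \in r] -> exists2 c, c \in r & uf F [set i | f i = c].
Proof.
elim: r => [|c r IH] h; first by have [] := filter_ex h.
have [h1|h1] := in_ultra_setVsetC [set i | f i = c] (uf_ultra F).
  by exists c => //; rewrite mem_head.
have [|c' c'r h2] := IH.
  by apply: filterS2 h h1 => i /=; rewrite inE => /orP[/eqP|].
by exists c' => //; rewrite inE c'r orbT.
Qed.

End Ultrapower.

Section DoubleUltrapower.
Context {I1 I2 : Type} {F1 : npultrafilter I1} {F2 : npultrafilter I2}.
Local Notation dst T := (dpower F1 F2 T).
Local Notation dclass := (@dclass I1 I2 F1 F2 _).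
Local Notation dae := (@dae I1 I2 F1 F2).

Lemma starE (T : Type) (x : I2 -> T) :
  star (uclass F2 x) = dclass (fun m _ => x m).
Proof. exact: ulift1E. Qed.

Lemma dcstE (T : Type) (x : T) : dcst x = dclass (fun _ _ => x).
Proof. exact: starE. Qed.

Lemma dclassD (T : zmodType) (f g : I2 -> I1 -> T) :
  dclass f + dclass g = dclass (fun m l => f m l + g m l).
Proof. exact: (dlift2E +%R). Qed.

Lemma dclassN (T : zmodType) (f : I2 -> I1 -> T) :
  - dclass f = dclass (fun m l => - f m l).
Proof. exact: (dlift1E -%R). Qed.

Lemma dclassM (T : comNzRingType) (f g : I2 -> I1 -> T) :
  dclass f * dclass g = dclass (fun m l => f m l * g m l).
Proof. exact: (dlift2E *%R). Qed.

Lemma dclassM3 (T : comNzRingType) (f g h : I2 -> I1 -> T) :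
  dclass f * dclass g * dclass h = dclass (fun m l => f m l * g m l * h m l).
Proof. by rewrite (dclassM f) dclassM. Qed.

Lemma dclassV (T : fieldType) (f : I2 -> I1 -> T) :
  (dclass f)^-1 = dclass (fun m l => (f m l)^-1).
Proof. exact: (dlift1E GRing.inv). Qed.

Lemma dclass2 (T : comNzRingType) : 2 = dclass (fun _ _ => 2 : T).
Proof. by rewrite mulr2n; exact: dclassD. Qed.

Lemma dclass_neq (T : Type) (f g : I2 -> I1 -> T) :
  dclass f <> dclass g <-> dae (fun m l => f m l <> g m l).
Proof.
split=> [fg|fg /dclassP h].
  by apply: dae_not => h; apply/fg/dclassP.
by apply: dae_false; apply: daeS (dae2 fg h) => m l [].
Qed.

Lemma dclass_le (d : Order.disp_t) (T : porderType d) (f g : I2 -> I1 -> T) :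
  (dclass f <= dclass g)%O <-> dae (fun m l => (f m l <= g m l)%O).
Proof.
rewrite /dclass; split=> [/uclass_le|h]; last apply/uclass_le.
  by apply: filterS => m /= /uclass_le.
by apply: filterS h => m /= h; apply/uclass_le.
Qed.

Lemma dclass_lt (d : Order.disp_t) (T : porderType d) (f g : I2 -> I1 -> T) :
  (dclass f < dclass g)%O <-> dae (fun m l => (f m l < g m l)%O).
Proof.
rewrite /dclass; split=> [/uclass_lt|h]; last apply/uclass_lt.
  by apply: filterS => m /= /uclass_lt.
by apply: filterS h => m /= h; apply/uclass_lt.
Qed.

Lemma daeT (P : I2 -> I1 -> Prop) : (forall m l, P m l) -> dae P.
Proof.
by move=> h; apply: filterS filterT => m _; apply: filterS filterT => l _; exact: h.
Qed.

(** Transfer of a bounded universal quantifier. If it failed almost everywhere, choosing a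
    counterexample at each pair of indices would give an internal element of [hset] violating
    [P]. *)
Lemma hset_forall (T : choiceType) (G : I2 -> I1 -> {fset T})
    (P : T -> I2 -> I1 -> Prop) :
  (forall x, hset (dclass G) (dclass x) -> dae (fun m l => P (x m l) m l)) <->
  dae (fun m l => forall t, t \in G m l -> P t m l).
Proof.
split=> [h|h x /in_hsetE xG]; last by apply: daeS (dae2 h xG) => m l [Pm xm]; exact: Pm.
apply: contrapT => /dae_not nP.
have [|x xG nPx] := @hset_wit _ _ F1 F2 T G (fun t m l => ~ P t m l).
  by apply: daeS nP => m l /existsNP[t /not_implyP[tg ne]]; exists t.
by apply: dae_false; apply: daeS (dae2 nPx (h _ xG)) => m l [].
Qed.

(** The representative is positive and even at every index, not just almost everywhere, so the
    finite lemmas apply without exception. *)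
Lemma even_urepr (H : ultrapower F2 int) : 0 < H ->
  (exists m : ultrapower F2 int, H = m *+ 2) ->
  exists n : I2 -> nat, H = uclass F2 (fun i => (n i).+1.*2%:Z).
Proof.
move=> + [M HM]; rewrite {}HM mulr2n; rewrite -(ureprK M).
move: (urepr M) => g.
rewrite uclassD => /uclass_lt g0; exists (fun i => (absz (g i)).-1).
apply/uclassP; apply: filterS g0 => i /=; case: (g i) => [[|k]|k] //= _.
by rewrite -addnn.
Qed.

Lemma even_durepr (H : dst int) : 0 < H ->
  (exists m : dst int, H = m *+ 2) ->
  exists n : I2 -> I1 -> nat, H = dclass (fun m l => (n m l).+1.*2%:Z).
Proof.
move=> + [M HM]; rewrite {}HM mulr2n; have [g ->] := dclass_surj M.
rewrite dclassD => /dclass_lt g0; exists (fun m l => (absz (g m l)).-1).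
apply/dclassP; apply: daeS g0 => m l /=; case: (g m l) => [[|k]|k] //= _.
by rewrite -addnn.
Qed.

(** As [hlim] is defined by choice, evaluating it needs uniqueness of limits. Two distinct limits,
    tested with half their distance at a common point near [w] but different from it, contradict the
    triangle inequality. *)
Lemma hlim_unique (R : realType) (f : dst R[i] -> dst R[i]) (w l : dst R[i]) :
  (forall e : dst R[i], 0 < e -> exists2 d : dst R[i], 0 < d &
    forall z, z != w -> hnorm (z - w) < d -> hnorm (f z - l) < e) ->
  hlim f w = l.
Proof.
move=> fl; apply: xget_unique => // l' fl'; apply: contrapT.
move: l l' w fl fl' => L L' W.
have [l ->] := dclass_surj L; have [l' ->] := dclass_surj L'.
have [w ->] := dclass_surj W => fl fl' /dclass_neq ll'.
have e0 : 0 < dclass (fun m j => `|l m j - l' m j| / 2).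
  apply/dclass_lt; apply: daeS ll' => m j /eqP.
  by rewrite eq_sym -subr_eq0 -normr_gt0 => h; rewrite divr_gt0.
have [D D0 fD] := fl _ e0; have [D' D'0 fD'] := fl' _ e0.
move: D D' D0 D'0 fD fD' => D D'.
have [d ->] := dclass_surj D; have [d' ->] := dclass_surj D'.
move=> /dclass_lt d0 /dclass_lt d'0 fD fD'.
(* Half the harmonic mean replaces the minimum, as the order on [R[i]] is
   only partial. *)
pose t m j := d m j * d' m j / (d m j + d' m j).
have tP : dae (fun m j => [/\ 0 < t m j, t m j < d m j & t m j < d' m j]).
  apply: daeS (dae2 d0 d'0) => m j [p p']; rewrite /t.
  have pp : 0 < d m j + d' m j by rewrite addr_gt0.
  rewrite divr_gt0 ?mulr_gt0 //; split=> //.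
    by rewrite ltr_pdivrMr // ltr_pM2l // ltrDr.
  by rewrite ltr_pdivrMr // mulrC ltr_pM2l // ltrDl.
pose z := dclass (fun m j => w m j + t m j).
have zw : z != dclass w.
  apply/eqP/dclass_neq; apply: daeS tP => m j [p _ _] /eqP.
  by rewrite -subr_eq0 addrAC subrr add0r gt_eqF.
have zn : hnorm (z - dclass w) = dclass t.
  rewrite /hnorm dclassN dclassD dlift1E; apply/dclassP.
  by apply: daeS tP => m j [p _ _]; rewrite addrAC subrr add0r gtr0_norm.
have {}fD : hnorm (f z - dclass l) < dclass (fun m j => `|l m j - l' m j| / 2).
  apply: (fD _ zw); rewrite zn; apply/dclass_lt.
  by apply: daeS tP => m j [].
have {}fD' : hnorm (f z - dclass l') < dclass (fun m j => `|l m j - l' m j| / 2).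
  apply: (fD' _ zw); rewrite zn; apply/dclass_lt.
  by apply: daeS tP => m j [].
have [y fz] := dclass_surj (f z).
move: fD fD'; rewrite fz /hnorm !dclassN !dclassD !dlift1E.
move=> /dclass_lt h /dclass_lt h'; apply: dae_false.
apply: daeS (dae2 h h') => m j [{}h {}h'].
have := ltrD h h'; rewrite -splitr => /lt_le_trans.
have tri : `|l m j - l' m j| <= `|y m j - l m j| + `|y m j - l' m j|.
  rewrite [X in _ <= X + _]distrC; apply: le_trans (ler_normD _ _).
  by rewrite addrA subrK.
by move=> /(_ _ tri); rewrite ltxx.
Qed.

End DoubleUltrapower.

(** * Internal description of the lattices and of the functionals *)

Section InternalLattices.
Context {R : realType} {I1 I2 : Type}.
Context {F1 : npultrafilter I1} {F2 : npultrafilter I2}.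
Local Notation dst T := (dpower F1 F2 T).
Local Notation dclass := (@dclass I1 I2 F1 F2 _).
Local Notation dae := (@dae I1 I2 F1 F2).
Context (n : I2 -> nat) (n' : I2 -> I1 -> nat).
Let N m := (n m).+1.*2.
Let N' m l := (n' m l).+1.*2.
Let H : ultrapower F2 int := uclass F2 (fun m => (N m)%:Z).
Let H' : dst int := dclass (fun m l => (N' m l)%:Z).
Let G := fun m (l : I1) => (grid (N m) : {fset R}).

Lemma hR_natE (k : I2 -> nat) :
  hR (uclass F2 (fun m => (k m)%:Z)) = uclass F2 (fun m => (k m)%:R : R).
Proof. exact: ulift1E. Qed.

Lemma dR_natE (k : I2 -> I1 -> nat) :
  dR (dclass (fun m l => (k m l)%:Z)) = dclass (fun m l => (k m l)%:R : R).
Proof. exact: dlift1E. Qed.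

Lemma dR_halfE (k : I2 -> I1 -> nat) :
  dR (dclass (fun m l => (k m l)%:Z)) / 2 =
  dclass (fun m l => (k m l)%:R / 2 : R).
Proof. by rewrite dR_natE dclass2 dclassV dclassM. Qed.

Lemma dC_E (x : I2 -> I1 -> R) : dC (dclass x) = dclass (fun m l => (x m l)%:C%C).
Proof. exact: dlift1E. Qed.

Lemma hexpM (z u : I2 -> I1 -> R[i]) :
  hexp (dclass z * dclass u) = dclass (fun m l => cexp (z m l * u m l)).
Proof. by rewrite dclassM; exact: dlift1E. Qed.

Lemma hsinhM (z u : I2 -> I1 -> R[i]) :
  hsinh (dclass z * dclass u) = dclass (fun m l => csinh (z m l * u m l)).
Proof. by rewrite dclassM; exact: dlift1E. Qed.

Lemma hlogE (k : I2 -> I1 -> nat) :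
  hlog (dclass k) = dclass (fun m l => ln (k m l)%:R : R).
Proof. exact: dlift1E. Qed.

Lemma mem_L (x : I2 -> R) :
  L H (uclass F2 x) <-> uf F2 [set m | x m \in grid (N m)].
Proof.
rewrite /L /= /eps hR_natE uclass2 !uclassV uclassM uclassN; split.
  move=> [z]; rewrite -(ureprK z); move: (urepr z) => {}z.
  rewrite /hR ulift1E uclassM => -[/uclassP h1 /andP[/uclass_le h2 /uclass_lt h3]].
  apply: filterS3 h1 h2 h3 => m /= h1 h2 h3; apply/gridP; exists (z m).
  by split=> //; apply/andP.
(* The integer numerators are chosen index by index, with an arbitrary value off the grid. *)
move=> xG; have /choice[z zP] (m : I2) : exists z : int, x m \in grid (N m) ->
    x m = (N m)%:R^-1 * z%:~R /\ - ((N m)%:R / 2) <= x m < (N m)%:R / 2.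
  have [/gridP[z zP]|h] := boolP (x m \in grid (N m)); first by exists z.
  by exists 0.
exists (uclass F2 z); rewrite /hR ulift1E uclassM; split.
  by apply/uclassP; apply: filterS xG => m /= /zP[].
apply/andP; split; [apply/uclass_le|apply/uclass_lt].
  by apply: filterS xG => m /= /zP[_ /andP[]].
by apply: filterS xG => m /= /zP[_ /andP[]].
Qed.

Lemma mem_L' (x : I2 -> I1 -> R) :
  L' H' (dclass x) <-> dae (fun m l => x m l \in grid (N' m l)).
Proof.
rewrite /L' /= /eps' dR_natE dclass2 !dclassV dclassM dclassN; split.
  move=> [z]; have [{}z ->] := dclass_surj z.
  rewrite /dR dlift1E dclassM => -[/dclassP h1 /andP[/dclass_le h2 /dclass_lt h3]].
  apply: daeS (dae2 h1 (dae2 h2 h3)) => m l [{}h1 [{}h2 {}h3]]; apply/gridP.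
  by exists (z m l); split=> //; apply/andP.
move=> xG; have [|z zP] := @dae_ex _ _ F1 F2 int (fun z m l =>
    x m l = (N' m l)%:R^-1 * z%:~R /\
    - ((N' m l)%:R / 2) <= x m l < (N' m l)%:R / 2) (fun _ _ => 0).
  by apply: daeS xG => m l /gridP.
exists (dclass z); rewrite /dR dlift1E dclassM; split.
  by apply/dclassP; apply: daeS zP => m l /= [].
apply/andP; split; [apply/dclass_le|apply/dclass_lt].
  by apply: daeS zP => m l /= [_ /andP[]].
by apply: daeS zP => m l /= [_ /andP[]].
Qed.

(* A function into a finite set is constant modulo an ultrafilter, so that the
   second ultrapower adds no element to [L]. *)
Lemma hset_grid_star (x : dst R) :
  hset (dclass G) x -> exists2 c, L H (uclass F2 c) & x = star (uclass F2 c).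
Proof.
have [{}x ->] := dclass_surj x => /in_hsetE xG.
have /choice[c cP] (m : I2) : exists c, uf F1 [set l | x m l \in G m l] ->
    c \in grid (N m) /\ uf F1 [set l | x m l = c].
  have [/uf_mem_seq[c cG h]|h] := pselect (uf F1 [set l | x m l \in G m l]).
    by exists c.
  by exists 0 => k; case: (h k).
exists c; first by apply/mem_L; apply: filterS xG => m /= /cP[].
by rewrite starE; apply/dclassP; apply: filterS xG => m /= /cP[].
Qed.

Lemma hset_grid : hset (dclass G) = star @` L H.
Proof.
apply/seteqP; split=> [x /hset_grid_star[c cL ->]|_ [x + <-]].
  by exists (uclass F2 c).
rewrite -(ureprK x); move: (urepr x) => {}x /mem_L xG.
rewrite starE; apply/in_hsetE; apply: filterS xG => m /= xm.
by apply: filterS filterT.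
Qed.

(** If [phi] takes all its internal values in [L], then for almost all [m] every [phi m l] is in the
    grid: otherwise a bad [l] chosen for each [m] would define an index at which [phi] leaves [L].
    Conversely, functions constant in [l] reach every star of an element of [L]. *)
Lemma star_set_L : star_set (L H) = hset (dclass G).
Proof.
apply/seteqP; split=> [_ [phi /= phiL <-]|x /hset_grid_star[c /mem_L cL ->]].
  move: phiL; rewrite -(ureprK phi); move: (urepr phi) => {}phi phiL.
  have h : uf F2 [set m | forall l, phi m l \in grid (N m)].
    have [//|h] := in_ultra_setVsetC
      [set m | forall l, phi m l \in grid (N m)] (uf_ultra F2).
    have [l0 _] := filter_ex (@filterT _ (uf F1) _).
    have /choice[l lP] (m : I2) : exists l, ~ (forall l, phi m l \in grid (N m)) ->
        phi m l \notin grid (N m).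
      have [h'|/existsNP[l /negP lP]] :=
        pselect (forall l, phi m l \in grid (N m)); first by exists l0.
      by exists l.
    have := phiL (uclass F2 l); rewrite ulift2E => /mem_L h'.
    exfalso; have : uf F2 set0.
      by apply: filterS2 h h' => m /= /lP /negP.
    by move=> /filter_ex[].
  rewrite ulift1E -[uclass F2 _]/(dclass phi); apply/in_hsetE.
  by apply: filterS h => m /= h; apply: filterS filterT => l _; exact: h.
exists (uclass F2 (fun m (_ : I1) => c m)); last by rewrite ulift1E starE.
move=> l; rewrite -(ureprK l) ulift2E; exact/mem_L.
Qed.

(** The hypothesis presents [f] as internal; [hbig_eq] then allows evaluation with the grids and
    [phi] as the chosen data. *)
Lemma hbig_L (V : Type) (op : V -> V -> V) (idx : V)
    (f : ultrapower F2 R -> dst V) (phi : I2 -> I1 -> R -> V) :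
  (forall x : I2 -> R, f (uclass F2 x) = dclass (fun m l => phi m l (x m))) ->
  hbig op idx star (L H) f =
  dclass (fun m l => \big[op/idx]_(x <- grid (N m)) phi m l x).
Proof.
move=> fphi; rewrite (@hbig_eq _ _ _ _ _ _ _ op idx star (L H) f (dclass G) (dclass phi)).
- exact: dlift2E.
- exact: hset_grid.
- move=> k _; rewrite -(ureprK k) starE fphi.
  by rewrite /happ dlift2E.
Qed.

Lemma ivalE (a : I2 -> I1 -> {fmap R -> R}) (x : I2 -> I1 -> R) :
  ival (dclass a) (dclass x) = dclass (fun m l => odflt 0 (a m l).[? x m l]%fmap).
Proof. exact: dlift2E. Qed.

(** [ffmapsP] transferred: the domain condition passes to representatives by [hset_inj], the
    condition on values by [hset_forall]. *)
Lemma X_hset :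
  X (R := R) H H' = hset (dclass (fun m l => ffmaps (grid (N m)) (grid (N' m l)))).
Proof.
have ffP (a : I2 -> I1 -> {fmap R -> R}) : dae (fun m l =>
      domf (a m l) = G m l /\ forall x, x \in G m l ->
        odflt 0 (a m l).[? x]%fmap \in grid (N' m l)) <->
    dae (fun m l => a m l \in ffmaps (grid (N m)) (grid (N' m l))).
  by split; apply: daeS => m l /ffmapsP.
apply/seteqP; split=> a; have [{}a ->] := dclass_surj a; last first.
  move=> /in_hsetE/ffP aP; split.
    rewrite /idom dlift1E star_set_L; congr hset; apply/dclassP.
    by apply: daeS aP => m l [].
  move=> k; rewrite star_set_L; have [x ->] := dclass_surj k => /in_hsetE xG.
  rewrite ivalE; apply/mem_L'; apply: daeS (dae2 aP xG) => m l [[_ h] ?].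
  exact: h.
rewrite /X /= /idom dlift1E star_set_L => -[/hset_inj/dclassP adom aL'].
apply/in_hsetE/ffP; apply: (dae2 adom).
apply/(hset_forall G (fun x m l => odflt 0 (a m l).[? x]%fmap \in grid (N' m l))).
by move=> x /aL'; rewrite ivalE => /mem_L'.
Qed.

Lemma hsum_X (V : zmodType) (f : dst {fmap R -> R} -> dst V)
    (phi : I2 -> I1 -> {fmap R -> R} -> V) :
  (forall a, f (dclass a) = dclass (fun m l => phi m l (a m l))) ->
  hsum id (X H H') f =
  dclass (fun m l => \sum_(a <- ffmaps (grid (N m)) (grid (N' m l))) phi m l a).
Proof.
move=> fphi; rewrite /hsum (@hbig_eq _ _ _ _ _ _ _ _ _ id (X H H') f
  (dclass (fun m l => ffmaps (grid (N m)) (grid (N' m l)))) (dclass phi)).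
- exact: dlift2E.
- by rewrite image_id X_hset.
- move=> a _; have [{}a ->] := dclass_surj a.
  by rewrite fphi /happ dlift2E.
Qed.

Lemma hquot_eq (f g : dst R[i] -> dst R[i]) (w l : dst R[i]) :
  (g w <> 0 -> f w / g w = l) ->
  (g w = 0 -> hlim (fun z => f z / g z) w = l) -> hquot f g w = l.
Proof. by rewrite /hquot; case: eqP => h h1 h2; [exact: h2|exact: h1]. Qed.

(** The denominator at [w] is nonzero almost everywhere or zero almost everywhere. In the first case
    [grid_geom_sum] applies at each index; in the second, radii from [grid_quot_lim] chosen at each
    index form an internal radius. *)
Lemma hquot_gridP (f g : dst R[i] -> dst R[i]) (w : I2 -> I1 -> R[i]) :
  (forall z, f (dclass z) =
     dclass (fun m l => csinh (z m l * ((N' m l)%:R / 2)%:C%C))) ->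
  (forall z, g (dclass z) =
     dclass (fun m l => cexp (- ((N' m l)%:R^-1 / 2)%:C%C * z m l) *
                        csinh (((N' m l)%:R^-1 / 2)%:C%C * z m l))) ->
  hquot f g (dclass w) =
  dclass (fun m l => \sum_(x <- grid (N' m l)) cexp (- x%:C%C * w m l)).
Proof.
move=> fE gE; apply: hquot_eq.
  rewrite fE gE dclassV dclassM => /dclass_neq Dw.
  apply/dclassP; apply: daeS Dw => m l /eqP Dw.
  by rewrite -grid_geom_sum // mulfK.
rewrite gE => /dclassP Dw; apply: hlim_unique => e.
have [{}e ->] := dclass_surj e => /dclass_lt e0.
have [|d dP] := @dae_ex _ _ F1 F2 R[i] (fun d m l => 0 < d /\
    forall z, z != w m l -> `|z - w m l| < d ->
    `|csinh (z * ((N' m l)%:R / 2)%:C%C) /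
       (cexp (- ((N' m l)%:R^-1 / 2)%:C%C * z) *
        csinh (((N' m l)%:R^-1 / 2)%:C%C * z)) -
      \sum_(x <- grid (N' m l)) cexp (- x%:C%C * w m l)| < e m l) (fun _ _ => 0).
  apply: daeS (dae2 Dw e0) => m l [{}Dw {}e0].
  by have [//|d d0 dP] := grid_quot_lim _ e0 Dw; exists d.
exists (dclass d); first by apply/dclass_lt; apply: daeS dP => m l [].
move=> z; have [{}z ->] := dclass_surj z => /eqP/dclass_neq zw.
rewrite fE gE dclassV dclassM /hnorm !dclassN !dclassD !dlift1E.
move=> /dclass_lt zd; apply/dclass_lt.
apply: daeS (dae2 dP (dae2 zw zd)) => m l [[_ {}dP] [/eqP {}zw {}zd]].
exact: dP.
Qed.

Lemma hquot_grid (w : I2 -> I1 -> R[i]) :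
  hquot (fun w => hsinh (w * dC (dR H' / 2)))
        (fun w => hexp (- dC (eps' H' / 2) * w) * hsinh (dC (eps' H' / 2) * w))
        (dclass w) =
  dclass (fun m l => \sum_(x <- grid (N' m l)) cexp (- x%:C%C * w m l)).
Proof.
apply: hquot_gridP => z; first by rewrite dR_halfE dC_E hsinhM.
have -> : eps' H' / 2 = dclass (fun m l => (N' m l)%:R^-1 / 2) :> dst R.
  by rewrite /eps' dR_natE dclass2 !dclassV dclassM.
by rewrite dC_E dclassN hsinhM hexpM dclassM.
Qed.

(** Finite counterpart of [q_]: for positive [K], at the point of [grid K] with index [i], the
    argument of [truncn] is [i + 1]. *)
Definition grid_prime (K : nat) (x : R) : nat :=
  nth_prime (Num.truncn (K%:R * (x + K%:R / 2) + 1)).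

(** On the grid the index is at least [1], which avoids [nth_prime 0 = 0]; positivity makes the
    logarithm additive on the product of the primes. *)
Lemma grid_prime_gt0 (k : nat) (x : R) :
  x \in grid k.+1.*2 -> (0 < grid_prime k.+1.*2 x)%N.
Proof.
move=> /gridP[_ [_ /andP[x0 _]]]; rewrite /grid_prime.
have : (0 < Num.truncn (k.+1.*2%:R * (x + k.+1.*2%:R / 2) + 1))%N.
  by rewrite truncn_gt_nat lerDr mulr_ge0 // -lerBlDr sub0r.
by case: (Num.truncn _) => // j _; exact/prime_gt0/nth_prime_prime.
Qed.

Lemma q_E (x : I2 -> R) :
  q_ H (uclass F2 x) = dclass (fun m _ => grid_prime (N m) (x m)).
Proof.
rewrite /q_ hR_natE uclass2 uclass1 uclassV (uclassM _ _ (fun=> 2^-1)).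
rewrite (uclassD _ x) uclassM uclassD.
rewrite /ptilde (ulift1E _ (fun y : R => Num.truncn y)) ulift1E.
exact: starE.
Qed.

Lemma Z_E (s : R[i]) (a : I2 -> I1 -> {fmap R -> R}) :
  Z_ H H' s (dclass a) = dclass (fun m l => \prod_(k <- grid (N m))
    cexp (- s * (odflt 0 (a m l).[? k]%fmap + (N' m l)%:R / 2)%:C%C *
          (ln (grid_prime (N m) k)%:R)%:C%C)).
Proof.
apply: hbig_L => x; rewrite q_E starE ivalE dR_halfE.
by rewrite dclassD dcstE /hpow hlogE !dC_E dclassN (dclassM (fun _ _ => - s)) hexpM.
Qed.

Lemma Z_internal (s : R[i]) : A H H' (Z_ H H' s).
Proof.
exists (dclass (fun m l (g : {fmap R -> R}) => \prod_(k <- grid (N m))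
  cexp (- s * (odflt 0 g.[? k]%fmap + (N' m l)%:R / 2)%:C%C *
        (ln (grid_prime (N m) k)%:R)%:C%C))) => a _.
by have [{}a ->] := dclass_surj a; rewrite Z_E /happ dlift2E.
Qed.

Lemma eps0E : eps0 H H' =
  dclass (fun m l => (N' m l)%:R ^ (- (N m)%:Z ^+ 2) : R).
Proof.
by rewrite /eps0 dR_natE starE expr2 dclassM dclassN dlift2E.
Qed.

Lemma dC_eps'E :
  dC (eps' H') = dclass (fun m l => ((N' m l)%:R^-1)%:C%C : R[i]).
Proof. by rewrite /eps' dR_natE dclassV dC_E. Qed.

Lemma w_E (s : R[i]) (b : I2 -> I1 -> {fmap R -> R}) (x : I2 -> R) :
  w_ H s (dclass b) (uclass F2 x) = dclass (fun m l =>
    (0 +i* (2 * pi))%C * (odflt 0 (b m l).[? x m]%fmap)%:C%C +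
    s * (ln (grid_prime (N m) (x m))%:R)%:C%C).
Proof.
rewrite /w_ q_E starE ivalE /two_pi_i !dcstE hlogE !dC_E.
by rewrite (dclassM (fun _ _ => s)) (dclassM (fun _ _ => (_ +i* _)%C)) dclassD.
Qed.

Lemma fourier_Z (s : R[i]) (b : dst {fmap R -> R}) :
  fourier H H' (Z_ H H' s) b =
    hpow (hprodn star (L H : set (ultrapower F2 R)) (q_ H))
         (- dcst s * dC (dR H' / 2)) *
    hprod star (L H) (fun k =>
      dC (eps' H') *
      hquot (fun w => hsinh (w * dC (dR H' / 2)))
            (fun w => hexp (- dC (eps' H' / 2) * w) *
                      hsinh (dC (eps' H' / 2) * w))
            (w_ H s b k)).
Proof.
have [{}b ->] := dclass_surj b.
pose q m := grid_prime (N m).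
pose c : R[i] := (0 +i* (2 * pi))%C.
rewrite /fourier (hsum_X (phi := fun m l a =>
  ((N' m l)%:R ^ (- (N m)%:Z ^+ 2))%:C%C *
  cexp (- c * (\sum_(k <- grid (N m))
     odflt 0 a.[? k]%fmap * odflt 0 (b m l).[? k]%fmap)%:C%C) *
  \prod_(k <- grid (N m))
    cexp (- s * (odflt 0 a.[? k]%fmap + (N' m l)%:R / 2)%:C%C *
          (ln (q m k)%:R)%:C%C))); last first.
  move=> a; rewrite Z_E eps0E /hsum (hbig_L _ _ (phi := fun m l k =>
    odflt 0 (a m l).[? k]%fmap * odflt 0 (b m l).[? k]%fmap)); last first.
    by move=> x; rewrite starE !ivalE dclassM.
  by rewrite /two_pi_i dcstE !dC_E dclassN hexpM dclassM3.
rewrite /hprod (hbig_L _ _ (phi := fun m l k => ((N' m l)%:R^-1)%:C%C *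
    \sum_(x <- grid (N' m l)) cexp (- x%:C%C *
      (c * (odflt 0 (b m l).[? k]%fmap)%:C%C + s * (ln (q m k)%:R)%:C%C)))); last first.
  by move=> x; rewrite w_E hquot_grid dC_eps'E dclassM.
rewrite /hprodn (hbig_L _ _ (phi := fun m l k => q m k)); last by move=> x; rewrite q_E.
rewrite /hpow hlogE dR_halfE dcstE !dC_E dclassN (dclassM (fun _ _ => - s)) hexpM.
(* Both sides are now classes of explicit families, and these agree at every pair of indices. *)
rewrite dclassM; apply/dclassP; apply: daeT => m l.
by apply: fourier_grid => // x; exact: grid_prime_gt0.
Qed.

End InternalLattices.

Theorem theorem7p1 (R : realType) (I1 I2 : Type)
  (I1_infinite : infinite_set [set: I1]) (I2_infinite : infinite_set [set: I2])
  (F1 : npultrafilter I1) (F2 : npultrafilter I2)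
  (H : ultrapower F2 int) (H' : dpower F1 F2 int)
  (H_gt0 : 0 < H) (H_even : exists m : ultrapower F2 int, H = m *+ 2)
  (H_infinite : forall n : int, ucst F2 n < H)
  (H'_gt0 : 0 < H')
  (H'_even : exists m : dpower F1 F2 int, H' = m *+ 2)
  (H'_infinite : forall x : ultrapower F2 int, star x < H')
  (s : R[i]) :
  A H H' (Z_ H H' s) /\
  forall b : dpower F1 F2 {fmap R -> R}, X H H' b ->
    fourier H H' (Z_ H H' s) b =
    hpow (hprodn star (L H : set (ultrapower F2 R)) (q_ H))
         (- dcst s * dC (dR H' / 2)) *
    hprod star (L H) (fun k =>
      dC (eps' H') *
      hquot (fun w => hsinh (w * dC (dR H' / 2)))
            (fun w => hexp (- dC (eps' H' / 2) * w) *
                      hsinh (dC (eps' H' / 2) * w))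
            (w_ H s b k)).
Proof.
(* Positivity and evenness provide representatives of the form [n.+1.*2], for which [L] and [X] are
   described by grids. *)
have [n ->] := even_urepr H_gt0 H_even.
have [n' ->] := even_durepr H'_gt0 H'_even.
split=> [|b _]; [exact: Z_internal|exact: fourier_Z].
Qed.
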